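(* Let $ABC$ be a triangle. The locus $\mathscr{L}_A$ of points $P$ (not on the extended sides of $ABC$ or of its anticomplementary triangle) whose generalized orthocenter is $H = A$ is a subset of the conic $\overline{\mathcal{C}}_A$ through $B, C, E_0$, and $F_0$, whose tangent at $B$ is $K^{-1}(AC)$ and whose tangent at $C$ is $K^{-1}(AB)$. Namely, $\mathscr{L}_A = \overline{\mathcal{C}}_A \setminus \{B, C, E_0, F_0\}$.
   Context: We work in the Euclidean plane extended by the line at infinity $l_\infty$. Two lines are parallel if they meet $l_\infty$ in the same point (a line is parallel to itself). Products of lines such as $AP\cdot BC$ denote intersection points. $ABC$ is a triangle with centroid $G$; $D_0,E_0,F_0$ are the midpoints of $BC,CA,AB$. $K$ is the complement map, the homothety with center $G$ and ratio $-1/2$; $K^{-1}(ABC)$ is the anticomplementary triangle. For a point $P$ (ordinary or infinite) not on the extended sides of $ABC$ or $K^{-1}(ABC)$, let $D=AP\cdot BC$, $E=BP\cdot CA$, $F=CP\cdot AB$ be its traces, and let $D_3,E_3,F_3$ be the reflections of $D,E,F$ in $D_0,E_0,F_0$; the lines $AD_3,BE_3,CF_3$ concur in $P'$, the isotomic conjugate of $P$. Let $Q=K(P')$. The generalized orthocenter $H$ of $P$ is the point lying on the lines through $A,B,C$ parallel respectively to $QD,QE,QF$ (these three lines are concurrent). *)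

(* Defs.v *)
From mathcomp Require Import all_boot all_order all_algebra.
From mathcomp Require Import classical_sets reals.
Set Implicit Arguments.
Unset Strict Implicit.
Unset Printing Implicit Defensive.
Import GRing.Theory Num.Theory.
Local Open Scope ring_scope.

(* The Euclidean plane is 'rV[R]_2; its extension by the line at infinity is
   the projective plane of R^(2+1), whose points and lines are the subspaces
   of dimension 1 and 2. Incidence is inclusion, the line joining two distinct
   points is their sum, and the intersection of two distinct lines is their
   intersection as subspaces. *)
Notation flat R := {vspace 'rV[R]_(2 + 1)}.

Definition is_point (R : realType) (X : flat R) : Prop := \dim X = 1%N.

Definition is_line (R : realType) (l : flat R) : Prop := \dim l = 2%N.

Definition pt (R : realType) (v : 'rV[R]_2) : flat R :=
  <[row_mx v (1%:M : 'M[R]_1)]>%VS.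

Definition linfty (R : realType) : flat R :=
  lker (linfun (@rsubmx R 1 2 1)).

Definition parallel (R : realType) (l m : flat R) : Prop :=
  (l :&: linfty R = m :&: linfty R)%VS.

(* (v, w) |-> (k v + (1 - k) w O, w) in homogeneous coordinates, that is
   v |-> O + k (v - O) on ordinary points; for k != 0, every point at infinity
   is fixed. *)
Definition homothety (R : realType) (O : 'rV[R]_2) (k : R) :
    'End('rV[R]_(2 + 1)) :=
  linfun (mulmxr (block_mx (k%:M : 'M[R]_2) 0 ((1 - k) *: O) (1%:M : 'M[R]_1))).

Definition reflection (R : realType) (O : 'rV[R]_2) : 'End('rV[R]_(2 + 1)) :=
  homothety O (- 1).

Definition midpoint (R : realType) (X Y : 'rV[R]_2) : 'rV[R]_2 :=
  2^-1 *: (X + Y).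

Definition is_triangle (R : realType) (A B C : 'rV[R]_2) : Prop :=
  free [:: B - A; C - A].

Definition centroid (R : realType) (A B C : 'rV[R]_2) : 'rV[R]_2 :=
  3^-1 *: (A + B + C).

Definition complement (R : realType) (A B C : 'rV[R]_2) :
    'End('rV[R]_(2 + 1)) :=
  homothety (centroid A B C) (- 2^-1).

Definition side (R : realType) (X Y : 'rV[R]_2) : flat R := (pt X + pt Y)%VS.

(* The line K^{-1}(XY), as the inverse image under K. *)
Definition anticomplement_line (R : realType) (A B C X Y : 'rV[R]_2) : flat R :=
  (complement A B C @^-1: side X Y)%VS.

Definition off_sides (R : realType) (A B C : 'rV[R]_2) (P : flat R) : Prop :=
  [/\ ~~ (P <= side B C)%VS, ~~ (P <= side C A)%VS & ~~ (P <= side A B)%VS] /\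
  [/\ ~~ (P <= anticomplement_line A B C B C)%VS,
      ~~ (P <= anticomplement_line A B C C A)%VS &
      ~~ (P <= anticomplement_line A B C A B)%VS].

(* The trace XP . YZ of P on the side YZ of the triangle XYZ. *)
Definition trace (R : realType) (X Y Z : 'rV[R]_2) (P : flat R) : flat R :=
  ((pt X + P) :&: side Y Z)%VS.

Definition reflected_trace (R : realType) (X Y Z : 'rV[R]_2) (P : flat R) :
    flat R :=
  (reflection (midpoint Y Z) @: trace X Y Z P)%VS.

Definition isotomic (R : realType) (A B C : 'rV[R]_2) (P : flat R) : flat R :=
  ((pt A + reflected_trace A B C P) :&: (pt B + reflected_trace B C A P)
     :&: (pt C + reflected_trace C A B P))%VS.

Definition isotomcomplement (R : realType) (A B C : 'rV[R]_2) (P : flat R) :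
    flat R :=
  (complement A B C @: isotomic A B C P)%VS.

Definition on_parallel_through (R : realType) (X : 'rV[R]_2) (l H : flat R) :
    Prop :=
  exists m : flat R,
    [/\ is_line m, (pt X <= m)%VS, parallel m l & (H <= m)%VS].

(* For P off the sides such an H is unique: the three parallels pass through
   A, B, C respectively, so they are not all equal. *)
Definition is_generalized_orthocenter (R : realType) (A B C : 'rV[R]_2)
    (P H : flat R) : Prop :=
  let Q := isotomcomplement A B C P in
  [/\ is_point H,
      on_parallel_through A (Q + trace A B C P)%VS H,
      on_parallel_through B (Q + trace B C A P)%VS H &
      on_parallel_through C (Q + trace C A B P)%VS H].

Definition locus (R : realType) (A B C : 'rV[R]_2) : set (flat R) :=
  [set P | [/\ is_point P, off_sides A B C P &
               is_generalized_orthocenter A B C P (pt A)]]%classic.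

(* A conic is given by the matrix M of a nondegenerate quadratic form, which
   is determined up to a nonzero factor. *)
Definition is_conic (R : realType) (M : 'M[R]_(2 + 1)) : Prop :=
  M^T = M /\ M \in unitmx.

Definition conic_points (R : realType) (M : 'M[R]_(2 + 1)) : set (flat R) :=
  [set X | is_point X /\ forall v, v \in X -> v *m M *m v^T = 0]%classic.

(* v *m M *m w^T is half the derivative at v, in the direction w, of the
   quadratic form of M. *)
Definition is_tangent (R : realType) (M : 'M[R]_(2 + 1)) (X l : flat R) : Prop :=
  [/\ conic_points M X, is_line l &
      forall v w, v \in X -> w \in l -> v *m M *m w^T = 0].

Definition is_conic_A (R : realType) (A B C : 'rV[R]_2) (M : 'M[R]_(2 + 1)) :
    Prop :=
  [/\ is_conic M,
      [/\ conic_points M (pt B), conic_points M (pt C),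
          conic_points M (pt (midpoint C A)) &
          conic_points M (pt (midpoint A B))],
      is_tangent M (pt B) (anticomplement_line A B C A C) &
      is_tangent M (pt C) (anticomplement_line A B C A B)].

(* Main.v *)
(* In barycentric coordinates let P = (x : y : z). Then D = (0 : y : z),
   P' = (yz : zx : xy) and Q = (x(y+z) : y(z+x) : z(x+y)). The orthocenter
   is A iff AB is parallel to QE and AC to QF, i.e. iff A - B lies in the span
   of Q and E and A - C in the span of Q and F. Off the sides, each of these is
   equivalent to x^2 = xy + yz + zx, and the points of this conic lying on a
   side or on a side of the anticomplementary triangle are B, C, E_0, F_0.
   Conversely the incidence and tangency conditions determine the Gram matrix
   of the conic in the basis A, B, C up to a factor. *)
Require Import Defs.
From mathcomp Require Import all_boot all_order all_algebra.
From mathcomp Require Import classical_sets reals.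
From mathcomp Require Import ring.
Set Implicit Arguments.
Unset Strict Implicit.
Unset Printing Implicit Defensive.
Import GRing.Theory Num.Theory.
Local Open Scope ring_scope.
Local Open Scope classical_set_scope.

(** * Points as one-dimensional subspaces *)

Lemma mem_line2P (F : fieldType) (vT : vectType F) (u v w : vT) :
  reflect (exists s t, w = s *: u + t *: v) (w \in <[u]> + <[v]>)%VS.
Proof.
apply: (iffP memv_addP) => [[_ /vlineP[s ->] [_ /vlineP[t ->] ->]]|[s [t ->]]].
  by exists s, t.
by exists (s *: u); [|exists (t *: v) => //]; rewrite memvZ ?memv_line.
Qed.

Lemma vlineZ (F : fieldType) (vT : vectType F) (k : F) (v : vT) :
  k != 0 -> <[k *: v]>%VS = <[v]>%VS.
Proof.
move=> k0; apply/eqP; rewrite eqEsubv -!memvE memvZ ?memv_line //=.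
by rewrite -[X in X \in _](scalerK k0) memvZ ?memv_line.
Qed.

Lemma vline_eqP (F : fieldType) (vT : vectType F) (u v : vT) :
  <[u]>%VS = <[v]>%VS -> exists k, u = k *: v.
Proof. by move=> uv; apply/vlineP; rewrite -uv memv_line. Qed.

Lemma is_pointP (R : realType) (X : flat R) :
  is_point X -> exists2 v, v != 0 & X = <[v]>%VS.
Proof.
rewrite /is_point => dX; exists (vpick X).
  by rewrite vpick0 -dimv_eq0 dX.
apply/esym/eqP; rewrite eqEdim -memvE memv_pick dX dim_vline vpick0.
by rewrite -dimv_eq0 dX.
Qed.

Lemma is_point_vline (R : realType) (v : 'rV[R]_(2 + 1)) :
  v != 0 -> is_point <[v]>%VS.
Proof. by move=> v0; rewrite /is_point dim_vline v0. Qed.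

(** * Barycentric coordinates with respect to three independent vectors *)

Definition bary (R : realType) (a b c : 'rV[R]_(2 + 1)) (x y z : R) :=
  x *: a + y *: b + z *: c.

(** Cyclic relabelling, which carries statements proved at the first vertex over to the other
    two. *)
Lemma baryC (R : realType) (a b c : 'rV[R]_(2 + 1)) (x y z : R) :
  bary a b c x y z = bary b c a y z x.
Proof. by rewrite /bary -addrA addrC. Qed.

Lemma free3C (R : realType) (a b c : 'rV[R]_(2 + 1)) :
  free [:: a; b; c] -> free [:: b; c; a].
Proof.
have /perm_free -> // : perm_eq [:: a; b; c] [:: b; c; a].
by rewrite perm_sym -[_ :: _]/(rot 1 [:: a; b; c]) perm_rot.
Qed.

Lemma free3_neq (R : realType) (a b c : 'rV[R]_(2 + 1)) :
  free [:: a; b; c] -> a != b.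
Proof.
by apply: contraTneq => ->; rewrite free_cons memv_span // inE eqxx.
Qed.

Lemma bary_eq0 (R : realType) (a b c : 'rV[R]_(2 + 1)) (x y z : R) :
  free [:: a; b; c] -> bary a b c x y z = 0 -> [/\ x = 0, y = 0 & z = 0].
Proof.
move=> /(@freeP _ _ _ [tuple a; b; c])/(_ (fun i => [:: x; y; z]`_i)) fr e0.
have {}fr : forall i : 'I_3, [:: x; y; z]`_i = 0.
  by apply: fr; rewrite !big_ord_recl big_ord0 addr0 addrA.
by split; [have := fr 0 | have := fr 1 | have := fr 2].
Qed.

Lemma bary_inj (R : realType) (a b c : 'rV[R]_(2 + 1)) (x y z x' y' z' : R) :
  free [:: a; b; c] -> bary a b c x y z = bary a b c x' y' z' ->
  [/\ x = x', y = y' & z = z'].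
Proof.
move=> fr e; have /(bary_eq0 fr)[] : bary a b c (x - x') (y - y') (z - z') = 0.
  rewrite -(subrr (bary a b c x y z)) {2}e.
  by apply/rowP => i; rewrite !mxE; ring.
by move=> /subr0_eq-> /subr0_eq-> /subr0_eq->.
Qed.

Lemma bary_neq0 (R : realType) (a b c : 'rV[R]_(2 + 1)) (x y z : R) :
  free [:: a; b; c] -> x != 0 -> bary a b c x y z != 0.
Proof. by move=> fr; apply: contra_neq => /(bary_eq0 fr)[]. Qed.

Lemma bary_surj (R : realType) (a b c v : 'rV[R]_(2 + 1)) :
  free [:: a; b; c] -> exists x y z, v = bary a b c x y z.
Proof.
move=> fr; have : v \in <<[tuple a; b; c]>>%VS.
  suff -> : <<[tuple a; b; c]>>%VS = fullv by rewrite memvf.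
  apply/eqP; rewrite eqEdim subvf dimvf /dim /= (eqP fr).
  by [].
move=> /coord_span->; rewrite !big_ord_recl big_ord0 addr0 addrA.
by do 3!eexists.
Qed.

Lemma bary_on_side (R : realType) (a b c : 'rV[R]_(2 + 1)) (x y z : R) :
  free [:: a; b; c] -> (bary a b c x y z \in <[b]> + <[c]>)%VS = (x == 0).
Proof.
move=> fr; apply/mem_line2P/eqP => [[s [t e]]|->]; last first.
  by exists y, z; rewrite /bary scale0r add0r.
suff /(bary_inj fr)[] : bary a b c x y z = bary a b c 0 s t by [].
by rewrite e /bary scale0r add0r.
Qed.

(** * Traces and the isotomic conjugate in coordinates *)

Lemma cevian_meet_side (R : realType) (a b c : 'rV[R]_(2 + 1)) (x y z : R) :
  free [:: a; b; c] -> y != 0 ->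
  ((<[a]> + <[bary a b c x y z]>) :&: (<[b]> + <[c]>) =
     <[y *: b + z *: c]>)%VS.
Proof.
move=> fr y0; apply/eqP; rewrite eqEsubv -memvE memv_cap.
apply/andP; split; last first.
  apply/andP; split; apply/mem_line2P; last by exists y, z.
  (* Subtracting [x *: a] from the point removes its [a]-coordinate; conversely, below, a vanishing
     [a]-coordinate forces [s = - (t * x)]. *)
  by exists (- x), 1; apply/rowP => i; rewrite !mxE; ring.
apply/subvP => _ /memv_capP[/mem_line2P[s [t ->]] /mem_line2P[s' [t' e]]].
suff /(bary_inj fr)[e1 _ _] : bary a b c (s + t * x) (t * y) (t * z) =
    bary a b c 0 s' t'.
  apply/vlineP; exists t; apply/rowP => i; rewrite !mxE.
  by have -> : s = - (t * x); [apply/eqP; rewrite -addr_eq0 e1 | ring].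
rewrite [RHS]/bary scale0r add0r -e.
by apply/rowP => i; rewrite !mxE; ring.
Qed.

Lemma isotomic_meet (R : realType) (a b c : 'rV[R]_(2 + 1)) (x y z : R) :
  free [:: a; b; c] -> x != 0 -> y != 0 -> z != 0 ->
  ((<[a]> + <[z *: b + y *: c]>) :&: (<[b]> + <[x *: c + z *: a]>)
     :&: (<[c]> + <[y *: a + x *: b]>) =
   <[bary a b c (y * z) (z * x) (x * y)]>)%VS.
Proof.
move=> fr x0 y0 z0; apply/eqP; rewrite eqEsubv -memvE !memv_cap.
apply/andP; split; last first.
  apply/andP; split; [apply/andP; split|]; apply/mem_line2P.
  - by exists (y * z), x; apply/rowP => i; rewrite !mxE; ring.
  - by exists (z * x), y; apply/rowP => i; rewrite !mxE; ring.
  - by exists (x * y), z; apply/rowP => i; rewrite !mxE; ring.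
apply/subvP => v /memv_capP[/memv_capP[/mem_line2P[s [t ->]]]].
(* The first two cevians already pin [v] down. The factor [t / x] is read off the [b]-coordinate:
   [t * z] must equal the factor times [z * x]. *)
move=> /mem_line2P[s' [t' e]] _; apply/vlineP; exists (t / x).
have : bary a b c s (t * z) (t * y) = bary a b c (t' * z) s' (t' * x).
  transitivity (s *: a + t *: (z *: b + y *: c)); last rewrite e.
    by apply/rowP => i; rewrite !mxE; ring.
  by apply/rowP => i; rewrite !mxE; ring.
move=> /(bary_inj fr)[-> _ e3]; apply/rowP => i; rewrite !mxE.
have -> : t' = t * y / x by rewrite e3 mulfK.
by field.
Qed.

(** * Ordinary points, the line at infinity and homotheties in homogeneous coordinates *)

Notation hom A := (row_mx A (1%:M : 'M_1)).

Lemma mem_linfty (R : realType) (v : 'rV[R]_2) (k : 'M[R]_1) :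
  (row_mx v k \in linfty R) = (k == 0).
Proof. by rewrite memv_ker lfunE /= row_mxKr. Qed.

(** Each [hom] vector ends in 1, so the last coordinate of the combination is the sum of its
    coefficients. *)
Lemma bary_linfty (R : realType) (A B C : 'rV[R]_2) (x y z : R) :
  (bary (hom A) (hom B) (hom C) x y z \in linfty R) = (x + y + z == 0).
Proof.
rewrite /bary !scale_row_mx !add_row_mx mem_linfty -!scalerDl.
by rewrite scaler_eq0 oner_eq0 orbF.
Qed.

(** In a vanishing combination the last coordinate makes the coefficients sum to zero. The planar
    part is then [k1 *: (B - A) + k2 *: (C - A)], so all coefficients vanish. *)
Lemma free_hom (R : realType) (A B C : 'rV[R]_2) :
  is_triangle A B C -> free [:: hom A; hom B; hom C].
Proof.
move=> /(@freeP _ _ _ [tuple B - A; C - A]) fr.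
apply/(@freeP _ _ _ [tuple hom A; hom B; hom C]) => k.
rewrite !big_ord_recl big_ord0 addr0 addrA /= => e.
have /eqP s0 : k 0 + k 1 + k 2 == 0.
  rewrite -(bary_linfty A B C) /bary.
  rewrite (_ : _ + _ = 0) ?mem0v // -[RHS]e.
  by congr (_ *: _ + k _ *: _ + k _ *: _); apply: val_inj.
move: e => /(congr1 lsubmx); rewrite !scale_row_mx !add_row_mx row_mxKl linear0.
set k1 := k (lift _ _); set k2 := k (lift _ _) => e.
have {}s0 : k 0 = - (k1 + k2).
  apply/eqP; rewrite -addr_eq0 addrA -s0; apply/eqP.
  by congr (_ + k _ + k _); apply: val_inj.
have e0 : forall i : 'I_2, [:: k1; k2]`_i = 0.
  apply: (fr (fun i => [:: k1; k2]`_i)).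
  rewrite !big_ord_recl big_ord0 addr0 /= -[RHS]e s0.
  by apply/rowP => i; rewrite !mxE; ring.
have /= k10 := e0 0; have /= k20 := e0 1.
case=> [[|[|[|//]]] lti].
- rewrite (_ : Ordinal lti = 0) ?s0 ?k10 ?k20 ?addr0 ?oppr0 //.
  exact: val_inj.
- by rewrite -[RHS]k10; congr k; apply: val_inj.
- by rewrite -[RHS]k20; congr k; apply: val_inj.
Qed.

Lemma homothetyE (R : realType) (O v : 'rV[R]_2) (k : R) (w : 'M[R]_1) :
  homothety O k (row_mx v w) = row_mx (k *: v + (1 - k) *: (w *m O)) w.
Proof.
rewrite lfunE /= mul_row_block mulmx1 mulmx0 add0r mul_mx_scalar.
by rewrite -scalemxAr.
Qed.

(** The reflection is linear on homogeneous vectors and exchanges [B] and [C]; this gives the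
    coordinates of the reflected traces. *)
Lemma reflection_side (R : realType) (B C : 'rV[R]_2) (y z : R) :
  reflection (midpoint B C) (y *: hom B + z *: hom C) =
    z *: hom B + y *: hom C.
Proof.
rewrite linearD !linearZ /= !homothetyE mul1mx !scale_row_mx !add_row_mx.
by congr row_mx; apply/rowP => i; rewrite !mxE; field.
Qed.

Lemma complementC (R : realType) (A B C : 'rV[R]_2) :
  complement A B C = complement B C A.
Proof. by rewrite /complement /centroid [B + C + A]addrC addrA. Qed.

(** K sends each vertex to the midpoint of the opposite side and is linear. *)
Lemma complement_bary (R : realType) (A B C : 'rV[R]_2) (x y z : R) :
  complement A B C (bary (hom A) (hom B) (hom C) x y z) =
    2^-1 *: bary (hom A) (hom B) (hom C) (y + z) (z + x) (x + y).
Proof.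
rewrite /bary !linearD !linearZ /= !homothetyE !mul1mx !scale_row_mx.
by rewrite !add_row_mx; congr row_mx; apply/rowP => i; rewrite !mxE; field.
Qed.

(** The first coordinate of the image under K is half of [y + z], and [BC] is where the first
    coordinate vanishes. *)
Lemma bary_anticomplement_line (R : realType) (A B C : 'rV[R]_2) (x y z : R) :
  free [:: hom A; hom B; hom C] ->
  (bary (hom A) (hom B) (hom C) x y z \in anticomplement_line A B C B C) =
    (y + z == 0).
Proof.
move=> fr; rewrite -memv_preim complement_bary.
set v := bary _ _ _ _ _ _; rewrite -[RHS](bary_on_side _ (z + x) (x + y) fr).
rewrite /side /pt -/v; apply/idP/idP => [|/memvZ]; last by apply.
by move/(memvZ 2); rewrite scalerA mulfV ?scale1r // pnatr_eq0.
Qed.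

Lemma anticomplement_lineC (R : realType) (A B C X Y : 'rV[R]_2) :
  anticomplement_line A B C X Y = anticomplement_line B C A X Y.
Proof. by rewrite /anticomplement_line complementC. Qed.

Lemma anticomplement_line_sym (R : realType) (A B C X Y : 'rV[R]_2) :
  anticomplement_line A B C X Y = anticomplement_line A B C Y X.
Proof. by rewrite /anticomplement_line /side addvC. Qed.

(** * The configuration attached to P in barycentric coordinates *)

Lemma off_sides_bary (R : realType) (A B C : 'rV[R]_2) (x y z : R) :
  free [:: hom A; hom B; hom C] ->
  off_sides A B C <[bary (hom A) (hom B) (hom C) x y z]> <->
    [/\ x != 0, y != 0 & z != 0] /\ [/\ y + z != 0, z + x != 0 & x + y != 0].
Proof.
move=> fr; have fr1 := free3C fr; have fr2 := free3C fr1.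
rewrite /off_sides -!memvE bary_on_side // bary_anticomplement_line //.
rewrite anticomplement_lineC baryC bary_on_side // bary_anticomplement_line //.
rewrite anticomplement_lineC [anticomplement_line _ _ _ A B]anticomplement_lineC.
by rewrite baryC bary_on_side // bary_anticomplement_line.
Qed.

Lemma trace_bary (R : realType) (A B C : 'rV[R]_2) (x y z : R) :
  free [:: hom A; hom B; hom C] -> y != 0 ->
  trace A B C <[bary (hom A) (hom B) (hom C) x y z]> =
    <[y *: hom B + z *: hom C]>%VS.
Proof. exact: cevian_meet_side. Qed.

Lemma reflected_trace_bary (R : realType) (A B C : 'rV[R]_2) (x y z : R) :
  free [:: hom A; hom B; hom C] -> y != 0 ->
  reflected_trace A B C <[bary (hom A) (hom B) (hom C) x y z]> =
    <[z *: hom B + y *: hom C]>%VS.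
Proof.
by move=> fr y0; rewrite /reflected_trace trace_bary // limg_line reflection_side.
Qed.

Lemma isotomcomplement_bary (R : realType) (A B C : 'rV[R]_2) (x y z : R) :
  free [:: hom A; hom B; hom C] -> x != 0 -> y != 0 -> z != 0 ->
  isotomcomplement A B C <[bary (hom A) (hom B) (hom C) x y z]> =
    <[bary (hom A) (hom B) (hom C) (x * (y + z)) (y * (z + x)) (z * (x + y))]>%VS.
Proof.
move=> fr x0 y0 z0; have fr1 := free3C fr; have fr2 := free3C fr1.
rewrite /isotomcomplement /isotomic reflected_trace_bary //.
rewrite [in reflected_trace B C A _]baryC reflected_trace_bary //.
rewrite [in reflected_trace C A B _]baryC.
rewrite [in reflected_trace C A B _]baryC reflected_trace_bary //.
rewrite isotomic_meet // limg_line complement_bary vlineZ; last first.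
  by rewrite invr_eq0 pnatr_eq0.
by congr <[bary _ _ _ _ _ _]>%VS; ring.
Qed.

(** * Parallels and points at infinity *)

(** The join has dimension at most 2 and contains [v], which is not at infinity. Its meet with the
    line at infinity is therefore a proper subspace, of dimension at most 1, and [d] spans it. *)
Lemma meet_linfty (R : realType) (u v d : 'rV[R]_(2 + 1)) :
  v \notin linfty R -> d != 0 -> d \in (<[u]> + <[v]>)%VS -> d \in linfty R ->
  ((<[u]> + <[v]>) :&: linfty R = <[d]>)%VS.
Proof.
move=> v0 d0 du di; apply/esym/eqP; rewrite eqEdim -memvE memv_cap du di /=.
rewrite dim_vline d0 -ltnS; set l := (<[u]> + <[v]>)%VS.
have dl : (\dim l <= 2)%N.
  apply: leq_trans (dimv_add_leqif _ _) _; rewrite !dim_vline.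
  exact: (leq_add (leq_b1 _) (leq_b1 _)).
apply: leq_trans dl; rewrite (ltn_leqif (dimv_leqif_sup (capvSl _ _))).
apply: contra v0 => /subvP/(_ v) vl; suff /vl/memv_capP[] : v \in l by [].
by apply: (subvP (addvSr _ _)); rewrite memv_line.
Qed.

Lemma is_line_join (R : realType) (d v : 'rV[R]_(2 + 1)) :
  v \notin linfty R -> d != 0 -> d \in linfty R ->
  is_line (<[d]> + <[v]>)%VS.
Proof.
move=> vi d0 di; rewrite /is_line dimv_disjoint_sum ?dim_vline ?d0.
  by case: eqVneq vi => [->|//]; rewrite mem0v.
apply/eqP; rewrite -subv0; apply/subvP => w /memv_capP[/vlineP[k ->]].
case/vlineP=> t e; have : t *: v \in linfty R by rewrite -e memvZ.
rewrite e; have [->|t0 ti] := eqVneq t 0; first by move=> _; rewrite scale0r mem0v.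
by case/negP: vi; rewrite -[v](scalerK t0) memvZ.
Qed.

Lemma hom_linftyN (R : realType) (X : 'rV[R]_2) : hom X \notin linfty R.
Proof. by rewrite mem_linfty oner_neq0. Qed.

(** Here [d] is the point at infinity of the given line, so the parallel through [X] is the join of
    [d] and [X]. *)
Lemma on_parallel_through_dir (R : realType) (X : 'rV[R]_2)
    (u v d w : 'rV[R]_(2 + 1)) :
  v \notin linfty R -> d != 0 -> d \in (<[u]> + <[v]>)%VS -> d \in linfty R ->
  w \in (<[d]> + pt X)%VS -> on_parallel_through X (<[u]> + <[v]>)%VS <[w]>.
Proof.
move=> vi d0 du di wm; exists (<[d]> + pt X)%VS; split.
- exact: is_line_join (hom_linftyN X) _ _.
- exact: addvSr.
- rewrite /parallel [RHS](meet_linfty vi d0) // (meet_linfty (hom_linftyN X) d0) //.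
  by apply: (subvP (addvSl _ _)); rewrite memv_line.
- by rewrite -memvE.
Qed.

(** The difference of the two [hom] vectors is the point at infinity of the line [XY]; parallelism
    says that the given line passes through it. *)
Lemma on_parallel_through_pt (R : realType) (X Y : 'rV[R]_2)
    (u v : 'rV[R]_(2 + 1)) :
  v \notin linfty R -> X != Y ->
  on_parallel_through X (<[u]> + <[v]>)%VS (pt Y) <->
    hom Y - hom X \in (<[u]> + <[v]>)%VS.
Proof.
move=> vi XY; have di : hom Y - hom X \in linfty R.
  by rewrite opp_row_mx add_row_mx mem_linfty subrr.
split=> [[m [_ Xm ml Ym]]|dl].
  have : hom Y - hom X \in (m :&: linfty R)%VS.
    by rewrite memv_cap di memvB // memvE.
  by rewrite ml => /memv_capP[].
apply: on_parallel_through_dir dl di _ => //.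
  by rewrite subr_eq0; apply: contra_neq XY => /eq_row_mx[].
by apply/mem_line2P; exists 1, 1; rewrite !scale1r subrK.
Qed.

(** * The equation expressing that the generalized orthocenter is A *)

Lemma orthocenter_bary (R : realType) (A B C : 'rV[R]_2) (x y z : R) :
  free [:: hom A; hom B; hom C] ->
  off_sides A B C <[bary (hom A) (hom B) (hom C) x y z]> ->
  is_generalized_orthocenter A B C <[bary (hom A) (hom B) (hom C) x y z]> (pt A)
    <-> x ^+ 2 = x * y + y * z + z * x.
Proof.
move=> fr /(off_sides_bary _ _ _ fr)[[x0 y0 z0] [yz0 zx0 xy0]].
have fr1 := free3C fr; have fr2 := free3C fr1.
rewrite /is_generalized_orthocenter isotomcomplement_bary // trace_bary //.
rewrite [in trace B C A _]baryC trace_bary //.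
rewrite [in trace C A B _]baryC [in trace C A B _]baryC trace_bary //.
set q := bary _ _ _ _ _ _.
have nAB : B != A.
  by rewrite eq_sym; apply: contra_neq (free3_neq fr) => ->.
have nAC : C != A by apply: contra_neq (free3_neq fr2) => ->.
have Di : y *: hom B + z *: hom C \notin linfty R.
  rewrite !scale_row_mx add_row_mx mem_linfty -scalerDl.
    by rewrite scaler_eq0 oner_eq0 orbF.
have Ei : z *: hom C + x *: hom A \notin linfty R.
  rewrite !scale_row_mx add_row_mx mem_linfty -scalerDl.
    by rewrite scaler_eq0 oner_eq0 orbF.
have Fi : x *: hom A + y *: hom B \notin linfty R.
  rewrite !scale_row_mx add_row_mx mem_linfty -scalerDl.
    by rewrite scaler_eq0 oner_eq0 orbF.
have HB := on_parallel_through_pt q Ei nAB.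
have HC := on_parallel_through_pt q Fi nAC.
split=> [[_ _ /HB/mem_line2P[s [t e]] _]|conic].
  (* The relation [A - B = s Q + t E] is compared coordinate by coordinate. The second coordinate
     gives [s != 0], the third gives [t] in terms of [s]. *)
  have /(bary_inj fr)[e1 e2 e3] : bary (hom A) (hom B) (hom C) 1 (- 1) 0 =
     bary (hom A) (hom B) (hom C) (s * (x * (y + z)) + t * x)
       (s * (y * (z + x))) (s * (z * (x + y)) + t * z).
    transitivity (hom A - hom B); last rewrite e /q;
      by apply/rowP => i; rewrite !mxE; ring.
  have s0 : s != 0.
    apply: contraTneq isT => s0; move/eqP: e2.
    by rewrite s0 mul0r oppr_eq0 oner_eq0.
  have et : t = - s * (x + y).
    apply: (mulIf z0); apply/eqP; rewrite -subr_eq0; apply/eqP.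
    by rewrite [RHS]e3; ring.
  apply: (mulfI s0); apply/esym; apply/eqP; rewrite -subr_eq0; apply/eqP.
  (* The first two coordinates of [A - B] add up to 0; after substituting [t], their sum is [s]
     times the conic equation. *)
  move: e1; rewrite et => e1; rewrite -[RHS](subrr 1) {1}e1 -[1]opprK e2. ring.
split.
- exact: is_point_vline (free_not0 fr (mem_head _ _)).
- (* the point at infinity of the line QD *)
  pose k := x * (y + z) + y * (z + x) + z * (x + y).
  pose d := bary (hom A) (hom B) (hom C) ((y + z) * (x * (y + z)))
    ((y + z) * (y * (z + x)) - k * y) ((y + z) * (z * (x + y)) - k * z).
  apply: (on_parallel_through_dir (d := d)) => //.
  + by rewrite bary_neq0 // !mulf_neq0.
  (* The coordinate sums of Q and D are [k] and [y + z], so [(y + z) Q - k D] has coordinate sum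
     0. *)
  + apply/mem_line2P; exists (y + z), (- k).
    by apply/rowP => i; rewrite !mxE; ring.
  + by rewrite bary_linfty /k; apply/eqP; ring.
  + by apply: (subvP (addvSr _ _)); rewrite memv_line.
(* These are the [s] and [t] that the second and third coordinates force: [s = -1 / (y (z + x))] and
   [t = - s (x + y)]. The conic equation settles the first coordinate, through the rewriting of
   [x * (y + z)]. *)
- apply/HB/mem_line2P; exists (- (y * (z + x))^-1), ((x + y) / (y * (z + x))).
  have conicy : x * (y + z) = x ^+ 2 - y * z by rewrite conic; ring.
  apply/rowP => i; rewrite /q conicy !mxE; field.
  by apply/andP.
- apply/HC/mem_line2P; exists (- (z * (x + y))^-1), ((z + x) / (z * (x + y))).
  have conicz : x * (y + z) = x ^+ 2 - y * z by rewrite conic; ring.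
  apply/rowP => i; rewrite /q conicz !mxE; field.
  by apply/andP.
Qed.

(** * The bilinear form of a conic, tangents and uniqueness *)

Definition bform (R : realType) (N : 'M[R]_(2 + 1)) (v w : 'rV[R]_(2 + 1)) : R :=
  (v *m N *m w^T) 0 0.

Lemma bform_eq0 (R : realType) (N : 'M[R]_(2 + 1)) (v w : 'rV[R]_(2 + 1)) :
  v *m N *m w^T = 0 <-> bform N v w = 0.
Proof.
by rewrite /bform; split=> [->|e]; [rewrite mxE | apply/rowP => i; rewrite ord1 e mxE].
Qed.

Lemma bform_sym (R : realType) (N : 'M[R]_(2 + 1)) (v w : 'rV[R]_(2 + 1)) :
  N^T = N -> bform N v w = bform N w v.
Proof.
move=> Nsym; rewrite /bform -[in RHS]Nsym.
by rewrite -[w in RHS]trmxK -!trmx_mul mulmxA [in RHS]mxE.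
Qed.

Lemma bform_bary (R : realType) (N : 'M[R]_(2 + 1)) (a b c v : 'rV[R]_(2 + 1))
    (x y z : R) :
  bform N v (bary a b c x y z) =
    x * bform N v a + y * bform N v b + z * bform N v c.
Proof.
by rewrite /bform /bary !linearD !linearZ /= !mxE.
Qed.

(** The form is homogeneous, so one representative of the point suffices. *)
Lemma conic_points_vline (R : realType) (N : 'M[R]_(2 + 1)) (v : 'rV[R]_(2 + 1)) :
  v != 0 -> conic_points N <[v]>%VS <-> bform N v v = 0.
Proof.
move=> v0; rewrite -bform_eq0; split=> [[_]|e]; first by apply; rewrite memv_line.
split; first exact: is_point_vline.
by move=> _ /vlineP[k ->]; rewrite -!scalemxAl linearZ -scalemxAr /= e !scaler0.
Qed.

Lemma hom_midpoint (R : realType) (X Y : 'rV[R]_2) :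
  hom (midpoint X Y) = 2^-1 *: (hom X + hom Y).
Proof.
rewrite add_row_mx scale_row_mx; congr row_mx.
by apply/rowP => i; rewrite !mxE; field.
Qed.

Lemma pt_midpoint (R : realType) (X Y : 'rV[R]_2) :
  pt (midpoint X Y) = <[hom X + hom Y]>%VS.
Proof. by rewrite /pt hom_midpoint vlineZ // invr_eq0 pnatr_eq0. Qed.

(** This side of the anticomplementary triangle is the line through [A] parallel to [BC]. *)
Lemma anticomplement_lineE (R : realType) (A B C : 'rV[R]_2) :
  free [:: hom A; hom B; hom C] ->
  anticomplement_line A B C B C = (<[hom B - hom C]> + <[hom A]>)%VS.
Proof.
move=> fr; apply/vspaceP => v; have [x [y [z ->]]] := bary_surj v fr.
rewrite bary_anticomplement_line //; apply/eqP/mem_line2P => [yz|[s [t]]].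
  exists y, x; have -> : z = - y by apply/eqP; rewrite -addr_eq0 addrC yz.
  by apply/rowP => i; rewrite !mxE; ring.
have -> : s *: (hom B - hom C) + t *: hom A =
    bary (hom A) (hom B) (hom C) t s (- s).
  by apply/rowP => i; rewrite !mxE; ring.
by move/(bary_inj fr) => [_ -> ->]; rewrite subrr.
Qed.

Lemma is_line_anticomplement (R : realType) (A B C : 'rV[R]_2) :
  free [:: hom A; hom B; hom C] -> is_line (anticomplement_line A B C B C).
Proof.
move=> fr; rewrite anticomplement_lineE //; apply: is_line_join.
- exact: hom_linftyN.
- by rewrite subr_eq0 (free3_neq (free3C fr)).
- by rewrite opp_row_mx add_row_mx mem_linfty subrr.
Qed.

(** Write [XY] for the form at two vertices. Incidence gives [BB = CC = 0], tangency at [B] gives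
    [BA = BC], tangency at [C] gives [CA = CB], and the midpoint of [CA] gives [AA = -2 BC]. Thus
    the Gram matrix is known up to the factor [BC]. *)
Lemma is_conic_A_bform (R : realType) (A B C : 'rV[R]_2) (N : 'M[R]_(2 + 1)) :
  free [:: hom A; hom B; hom C] -> is_conic_A A B C N ->
  exists2 k, k != 0 & forall x y z,
    let v := bary (hom A) (hom B) (hom C) x y z in
    bform N v v = k * (x * y + y * z + z * x - x ^+ 2).
Proof.
move=> fr [[Nsym Nu] [Bc Cc Ec Fc] [_ _ Bt] [_ _ Ct]].
have fr1 := free3C fr; have fr2 := free3C fr1.
have a0 := free_not0 fr (mem_head _ _).
have b0 := free_not0 fr1 (mem_head _ _).
have c0 := free_not0 fr2 (mem_head _ _).
have hX (X : 'rV[R]_2) : hom X \in pt X by rewrite memv_line.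
have bb : bform N (hom B) (hom B) = 0 by apply/conic_points_vline.
have cc : bform N (hom C) (hom C) = 0 by apply/conic_points_vline.
have bt : bform N (hom B) (hom C - hom A) = 0.
  apply/bform_eq0/(Bt _ _ (hX B)); rewrite anticomplement_line_sym anticomplement_lineC.
  rewrite anticomplement_lineE //.
  by apply: (subvP (addvSl _ _)); rewrite memv_line.
have ct : bform N (hom C) (hom A - hom B) = 0.
  apply/bform_eq0/(Ct _ _ (hX C)); rewrite 2!anticomplement_lineC anticomplement_lineE //.
  by apply: (subvP (addvSl _ _)); rewrite memv_line.
have bL v w u : bform N v (w + u) = bform N v w + bform N v u.
  by rewrite /bform !linearD mxE.
have bN v w : bform N v (- w) = - bform N v w by rewrite /bform !linearN mxE.
have bsym v w : bform N v w = bform N w v by exact: bform_sym.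
have ba : bform N (hom A) (hom B) = bform N (hom B) (hom C).
  by apply/eqP; rewrite bsym eq_sym -subr_eq0 -bN -bL bt.
have ca : bform N (hom C) (hom A) = bform N (hom B) (hom C).
  by rewrite [RHS]bsym; apply/eqP; rewrite -subr_eq0 -bN -bL ct.
have aa : bform N (hom A) (hom A) = - 2 * bform N (hom B) (hom C).
  have ac0 : hom C + hom A != 0.
    rewrite (_ : _ + _ = bary (hom A) (hom B) (hom C) 1 0 1) ?bary_neq0 //.
      by rewrite oner_neq0.
    by rewrite /bary scale0r !scale1r addr0 addrC.
  move: Ec; rewrite pt_midpoint => /(conic_points_vline _ ac0).
  rewrite bL ![bform N (_ + _) _]bsym !bL cc ca [bform N (hom A) (hom C)]bsym ca.
  by move=> e; apply/eqP; rewrite -subr_eq0 -[X in _ == X]e; apply/eqP; ring.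
exists (2 * bform N (hom B) (hom C)) => [|x y z v].
  (* If [BC] vanished, [A] would be orthogonal to all three vertices, hence to every vector,
     contradicting the invertibility of [N]. *)
  rewrite mulf_eq0 pnatr_eq0 /=; apply: contraNneq a0 => k0.
  suff : hom A *m N = 0 by move/(canRL (mulmxK Nu)); rewrite mul0mx => ->.
  apply/rowP => i; have [x [y [z e]]] := bary_surj (delta_mx 0 i) fr.
  have -> : (hom A *m N) 0 i = bform N (hom A) (delta_mx 0 i).
    by rewrite /bform trmx_delta -colE [RHS]mxE.
  rewrite e bform_bary aa ba [bform N (hom A) (hom C)]bsym ca k0 mxE; ring.
rewrite /v bform_bary ![bform N (bary _ _ _ _ _ _) _]bsym !bform_bary.
rewrite aa bb cc [bform N (hom B) (hom A)]bsym [bform N (hom A) (hom C)]bsym.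
rewrite [bform N (hom C) (hom B)]bsym ba ca; ring.
Qed.

(** * Existence of the conic *)

(* The quadratic form 2 (xy + yz + zx - x^2). *)
Definition conic_A_gram (R : realType) : 'M[R]_(2 + 1) :=
  \matrix_(i, j) (nth [::] [:: [:: - 2; 1; 1]; [:: 1; 0; 1]; [:: 1; 1; 0]] i)`_j.

Lemma conic_A_gram_unit (R : realType) : conic_A_gram R \in unitmx.
Proof.
(* The explicit inverse: the adjugate divided by the determinant 4. *)
pose B : 'M[R]_(2 + 1) := \matrix_(i, j)
  (nth [::] [:: [:: - 4^-1; 4^-1; 4^-1]; [:: 4^-1; - 4^-1; 3 / 4];
                [:: 4^-1; 3 / 4; - 4^-1]] i)`_j.
suff /mulmx1_unit[] : conic_A_gram R *m B = 1%:M by [].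
apply/matrixP => -[[|[|[|//]]] ?] [[|[|[|//]]] ?];
  by rewrite !mxE !big_ord_recl big_ord0 !mxE /=; field.
Qed.

(** Change of basis: right multiplication takes a row of barycentric coordinates to the homogeneous
    vector. *)
Definition vertex_mx (R : realType) (A B C : 'rV[R]_2) : 'M[R]_(2 + 1) :=
  \matrix_i [:: hom A; hom B; hom C]`_i.

Definition row3 (R : realType) (x y z : R) : 'rV[R]_(2 + 1) :=
  \row_i [:: x; y; z]`_i.

Lemma row3_vertex_mx (R : realType) (A B C : 'rV[R]_2) (x y z : R) :
  row3 x y z *m vertex_mx A B C = bary (hom A) (hom B) (hom C) x y z.
Proof.
apply/rowP => i; rewrite !mxE !big_ord_recl big_ord0 !mxE /=.
by rewrite addr0 addrA.
Qed.

Lemma vertex_mx_unit (R : realType) (A B C : 'rV[R]_2) :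
  free [:: hom A; hom B; hom C] -> vertex_mx A B C \in unitmx.
Proof.
move=> fr; rewrite -row_free_unit; apply: inj_row_free => v.
have -> : v = row3 (v 0 0) (v 0 1) (v 0 (lift 0 (lift 0 ord0))).
  apply/rowP => -[[|[|[|//]]] ?]; rewrite mxE /=; congr (v _ _); exact: val_inj.
rewrite row3_vertex_mx => /(bary_eq0 fr)[-> -> ->].
by apply/rowP => -[[|[|[|//]]] ?]; rewrite !mxE.
Qed.

Lemma conic_A_exists (R : realType) (A B C : 'rV[R]_2) :
  free [:: hom A; hom B; hom C] ->
  exists2 M : 'M[R]_(2 + 1), is_conic M & forall x y z x' y' z',
    bform M (bary (hom A) (hom B) (hom C) x y z)
      (bary (hom A) (hom B) (hom C) x' y' z') =
    x * (y' + z' - 2 * x') + y * (z' + x') + z * (x' + y').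
Proof.
move=> fr; have Tu := vertex_mx_unit fr.
pose T := invmx (vertex_mx A B C).
(* Right multiplication by [T] recovers barycentric coordinates, so this congruent matrix evaluates
   [conic_A_gram] on them. *)
exists (T *m conic_A_gram R *m T^T) => [|x y z x' y' z'].
  split; last by rewrite !unitmx_mul unitmx_tr unitmx_inv Tu conic_A_gram_unit.
  rewrite !trmx_mul trmxK mulmxA; congr (_ *m _ *m _).
  by apply/matrixP => -[[|[|[|//]]] ?] [[|[|[|//]]] ?]; rewrite !mxE.
rewrite /bform -!row3_vertex_mx trmx_mul !mulmxA mulmxK //.
rewrite -!mulmxA (mulmxA _^T) -trmx_mul mulmxV // trmx1 mul1mx.
rewrite !mxE !big_ord_recl big_ord0 !mxE !big_ord_recl !big_ord0 !mxE /=.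
ring.
Qed.

(** At [B] the form becomes [z' + x'] and at [C] it becomes [x' + y']. Their zero sets are exactly
    the two prescribed tangents; the incidences follow by substitution. *)
Lemma is_conic_AP (R : realType) (A B C : 'rV[R]_2) (M : 'M[R]_(2 + 1)) :
  free [:: hom A; hom B; hom C] -> is_conic M ->
  (forall x y z x' y' z',
    bform M (bary (hom A) (hom B) (hom C) x y z)
      (bary (hom A) (hom B) (hom C) x' y' z') =
    x * (y' + z' - 2 * x') + y * (z' + x') + z * (x' + y')) ->
  is_conic_A A B C M.
Proof.
move=> fr hM ME; have fr1 := free3C fr; have fr2 := free3C fr1.
have eB : hom B = bary (hom A) (hom B) (hom C) 0 1 0.
  by rewrite /bary !scale0r scale1r addr0 add0r.
have eC : hom C = bary (hom A) (hom B) (hom C) 0 0 1.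
  by rewrite /bary !scale0r scale1r !add0r.
have eE : hom C + hom A = bary (hom A) (hom B) (hom C) 1 0 1.
  by rewrite /bary scale0r !scale1r addr0 addrC.
have eF : hom A + hom B = bary (hom A) (hom B) (hom C) 1 1 0.
  by rewrite /bary scale0r !scale1r addr0.
have Bc : conic_points M (pt B).
  apply/conic_points_vline; first exact: free_not0 fr1 (mem_head _ _).
  by rewrite eB ME; ring.
have Cc : conic_points M (pt C).
  apply/conic_points_vline; first exact: free_not0 fr2 (mem_head _ _).
  by rewrite eC ME; ring.
have Et : anticomplement_line A B C A C = anticomplement_line B C A C A.
  by rewrite anticomplement_line_sym anticomplement_lineC.
have Ft : anticomplement_line A B C A B = anticomplement_line C A B A B.
  by rewrite 2!anticomplement_lineC.
split; first exact: hM.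
- split; [exact: Bc | exact: Cc | |]; rewrite pt_midpoint;
    apply/conic_points_vline.
  + by rewrite eE bary_neq0 ?oner_neq0.
  + by rewrite eE ME; ring.
  + by rewrite eF bary_neq0 ?oner_neq0.
  + by rewrite eF ME; ring.
- split=> [||_ w /vlineP[k ->]]; [exact: Bc | |]; rewrite Et.
    exact: is_line_anticomplement.
  have [x [y [z ->]]] := bary_surj w fr; rewrite baryC.
  rewrite (bary_anticomplement_line _ _ _ fr1) -baryC => /eqP zx.
  have /bform_eq0 e : bform M (hom B) (bary (hom A) (hom B) (hom C) x y z) = 0.
    by rewrite [X in bform _ X _]eB ME zx; ring.
  by rewrite -!scalemxAl e scaler0.
- split=> [||_ w /vlineP[k ->]]; [exact: Cc | |]; rewrite Ft.
    exact: is_line_anticomplement.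
  have [x [y [z ->]]] := bary_surj w fr; rewrite 2!baryC.
  rewrite (bary_anticomplement_line _ _ _ fr2) -2!baryC => /eqP xy.
  have /bform_eq0 e : bform M (hom C) (bary (hom A) (hom B) (hom C) x y z) = 0.
    by rewrite [X in bform _ X _]eC ME xy; ring.
  by rewrite -!scalemxAl e scaler0.
Qed.

(** * Points of the conic and the excluded lines *)

(** The resulting equation does not mention [N], which yields the uniqueness of the point set. *)
Lemma conic_A_points_bary (R : realType) (A B C : 'rV[R]_2) (N : 'M[R]_(2 + 1))
    (x y z : R) :
  free [:: hom A; hom B; hom C] -> is_conic_A A B C N ->
  bary (hom A) (hom B) (hom C) x y z != 0 ->
  conic_points N <[bary (hom A) (hom B) (hom C) x y z]>%VS <->
    x ^+ 2 = x * y + y * z + z * x.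
Proof.
move=> fr hN v0; have [k k0 Nk] := is_conic_A_bform fr hN.
rewrite conic_points_vline // Nk; split=> [/eqP|->]; last by rewrite subrr mulr0.
by rewrite mulf_eq0 (negbTE k0) subr_eq0 => /eqP.
Qed.

Lemma conic_A_off_sides (R : realType) (A B C : 'rV[R]_2) (x y z : R) :
  let P := <[bary (hom A) (hom B) (hom C) x y z]>%VS in
  free [:: hom A; hom B; hom C] -> bary (hom A) (hom B) (hom C) x y z != 0 ->
  x ^+ 2 = x * y + y * z + z * x ->
  off_sides A B C P <->
  ~ [\/ P = pt B, P = pt C, P = pt (midpoint C A) | P = pt (midpoint A B)].
Proof.
move=> P fr v0 conic; rewrite !pt_midpoint off_sides_bary //.
have coord u v w : P = <[bary (hom A) (hom B) (hom C) u v w]>%VS ->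
    exists k, [/\ x = k * u, y = k * v & z = k * w].
  case/vline_eqP=> k e; exists k; apply: (bary_inj fr); rewrite e.
  by apply/rowP => i; rewrite !mxE; ring.
split.
  case=> -[x0 y0 z0] _ [].
  - have -> : pt B = <[bary (hom A) (hom B) (hom C) 0 1 0]>%VS.
      by rewrite /bary !scale0r scale1r addr0 add0r.
    by case/coord=> k [/eqP]; rewrite mulr0 (negbTE x0).
  - have -> : pt C = <[bary (hom A) (hom B) (hom C) 0 0 1]>%VS.
      by rewrite /bary !scale0r scale1r !add0r.
    by case/coord=> k [/eqP]; rewrite mulr0 (negbTE x0).
  - have -> : hom C + hom A = bary (hom A) (hom B) (hom C) 1 0 1.
      by rewrite /bary scale0r !scale1r addr0 addrC.
    by case/coord=> k [_ /eqP]; rewrite mulr0 (negbTE y0).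
  - have -> : hom A + hom B = bary (hom A) (hom B) (hom C) 1 1 0.
      by rewrite /bary scale0r !scale1r addr0.
    by case/coord=> k [_ _ /eqP]; rewrite mulr0 (negbTE z0).
move=> exc.
have onlyB : x = 0 -> z = 0 -> False.
  move=> x0 z0; apply: exc; constructor 1; move: v0; rewrite /P x0 z0 /bary.
  rewrite !scale0r addr0 add0r scaler_eq0 negb_or => /andP[y0 _].
  exact: vlineZ.
have onlyC : x = 0 -> y = 0 -> False.
  move=> x0 y0; apply: exc; constructor 2; move: v0; rewrite /P x0 y0 /bary.
  rewrite !scale0r !add0r scaler_eq0 negb_or => /andP[z0 _].
  exact: vlineZ.
(* On [x = 0] the conic equation reduces to [y * z = 0], leaving only [B] and [C]. *)
have x0 : x != 0.
  apply/eqP => x0; move/eqP: conic.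
  rewrite x0 expr0n mul0r mulr0 addr0 add0r eq_sym mulf_eq0.
  by case/orP=> /eqP; [apply: onlyC | apply: onlyB].
(* On [y = 0] it reduces to [x ^+ 2 = z * x], so [z = x] and the point is the midpoint of [CA]; the
   case [z = 0] is symmetric. *)
have y0 : y != 0.
  apply/eqP => y0; apply: exc; constructor 3.
  have e : z = x by apply: (mulIf x0); rewrite -expr2 conic y0; ring.
  by rewrite /P y0 e /bary scale0r addr0 -scalerDr [hom A + _]addrC vlineZ.
have z0 : z != 0.
  apply/eqP => z0; apply: exc; constructor 4.
  have e : y = x by apply: (mulIf x0); rewrite -expr2 conic z0; ring.
  by rewrite /P z0 e /bary scale0r addr0 -scalerDr vlineZ.
(* On an anticomplementary side the equation becomes [x ^+ 2 + z ^+ 2 = 0] or [2 x ^+ 2 = 0],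
   impossible over the reals since [x != 0]. *)
split=> //; split; apply/eqP => /eqP; rewrite addr_eq0 => /eqP e.
- have /eqP : x ^+ 2 + z ^+ 2 = 0 by rewrite conic e; ring.
  by rewrite paddr_eq0 ?sqr_ge0 // !sqrf_eq0 (negbTE x0).
- have /eqP : x ^+ 2 + x ^+ 2 = 0 by rewrite {2}conic e; ring.
  by rewrite paddr_eq0 ?sqr_ge0 // !sqrf_eq0 (negbTE x0).
- have /eqP : x ^+ 2 + x ^+ 2 = 0 by rewrite {2}conic e; ring.
  by rewrite paddr_eq0 ?sqr_ge0 // !sqrf_eq0 (negbTE x0).
Qed.

Theorem theorem4p2 (R : realType) (A B C : 'rV[R]_2)
    (hABC : is_triangle A B C) :
  exists M : 'M[R]_(2 + 1),
    [/\ is_conic_A A B C M,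
        forall N : 'M[R]_(2 + 1), is_conic_A A B C N ->
          conic_points N = conic_points M,
        locus A B C `<=` conic_points M &
        locus A B C = conic_points M `\`
          [set X | [\/ X = pt B, X = pt C,
                       X = pt (midpoint C A) | X = pt (midpoint A B)]]].
Proof.
have fr := free_hom hABC.
have [M cM ME] := conic_A_exists fr; have hM := is_conic_AP fr cM ME.
exists M.
have barP (P : flat R) : is_point P -> exists x y z,
    bary (hom A) (hom B) (hom C) x y z != 0 /\
    P = <[bary (hom A) (hom B) (hom C) x y z]>%VS.
  move=> /is_pointP[v v0 ->]; have [x [y [z e]]] := bary_surj v fr.
  by exists x, y, z; rewrite -e.
have locE : locus A B C = conic_points M `\`
    [set X | [\/ X = pt B, X = pt C,
                 X = pt (midpoint C A) | X = pt (midpoint A B)]].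
  apply/seteqP; split=> P.
    case=> /barP[x [y [z [v0 ->]]]] off /(orthocenter_bary fr off) conic; split.
      exact/conic_A_points_bary.
    exact/conic_A_off_sides.
  case=> Pc; case: (Pc) => /barP[x [y [z [v0 eP]]]] _; move: Pc; rewrite eP.
  move=> /(conic_A_points_bary fr hM v0) conic.
  move=> /(conic_A_off_sides fr v0 conic) off.
  by split=> //; [exact: is_point_vline | apply/orthocenter_bary].
split=> //; last by rewrite locE => P [].
(* Both point sets have the same equation in barycentric coordinates. *)
move=> N hN; apply/seteqP; split=> P Pc; case: (Pc) => /barP[x [y [z [v0 eP]]]] _;
  move: Pc; rewrite eP.
- by move=> /(conic_A_points_bary fr hN v0)/(conic_A_points_bary fr hM v0).
- by move=> /(conic_A_points_bary fr hM v0)/(conic_A_points_bary fr hN v0).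
Qed.
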